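(* Let $n,k\in\mathbb{N}$ and let $\lambda$ be a partition of depth at most $kn$. The Schur function $s_\lambda(x)$ in the $kn$ variables $x=(x_1,\dots,x_{kn})$ is written as $$s_\lambda(x)=\frac1{\operatorname{wrdet}_k V_{n,k}(x)}\sum_{\substack{\mu\le\lambda\\ |\mu|=|\lambda|}}\ \sum_{\sigma\in\mathfrak{S}_{kn}/\mathfrak{S}_\mu}K_{\lambda\mu}\cdot D_{n,k}\Bigl(x;\boldsymbol{\delta}_{n,k}+\sum_{i=1}^{kn}\mu_{\sigma(i)}\boldsymbol{e}_i\Bigr),$$ where the outer sum is over partitions $\mu=(\mu_1,\dots,\mu_{kn})$ of depth at most $kn$ and the inner sum is over representatives $\sigma$ of the cosets $\mathfrak{S}_\mu\sigma$ in $\mathfrak{S}_{kn}$.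
   Context: $\mathfrak{S}_N$ is the symmetric group of degree $N$ and $\nu_N(w)$ is the number of cycles of $w\in\mathfrak{S}_N$ (fixed points included). For an $N\times N$ matrix $B=(b_{ij})$ with entries in a commutative $\mathbb{C}$-algebra, $\det_k B:=\sum_{w\in\mathfrak{S}_N}(-\tfrac1k)^{N-\nu_N(w)}b_{w(1)1}\cdots b_{w(N)N}$. For a matrix $A$ with $n$ columns, $A^{[k]}$ is obtained by repeating each column $k$ times consecutively, and for a $kn\times n$ matrix $A$, $\operatorname{wrdet}_k A:=\det_k(A^{[k]})$. $V_{n,k}(x)=(x_i^{n-j})_{1\le i\le kn,1\le j\le n}$. For $\boldsymbol{a}=(a_1,\dots,a_{kn})\in\mathbb{Z}_{\ge0}^{kn}$, $D_{n,k}(x;\boldsymbol{a})=\det_k(x_i^{a_j})_{1\le i,j\le kn}$. $\boldsymbol{e}_i\in\mathbb{Z}_{\ge0}^{kn}$ is the $i$-th standard basis vector and $\boldsymbol{\delta}_{n,k}=\sum_{j=1}^{kn}\bigl(n-1-\lfloor\frac{j-1}k\rfloor\bigr)\boldsymbol{e}_j$; note $\operatorname{wrdet}_kV_{n,k}(x)=D_{n,k}(x;\boldsymbol{\delta}_{n,k})$. Partitions are padded by zeros to length $kn$; $\mu\le\lambda$ is the dominance order; $\mathfrak{S}_\mu=\{\sigma\in\mathfrak{S}_{kn}:\mu_{\sigma(i)}=\mu_i,\ 1\le i\le kn\}$; $K_{\lambda\mu}$ is the Kostka number (the number of semistandard tableaux of shape $\lambda$ and weight $\mu$). With $N=kn$,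 $s_\lambda(x_1,\dots,x_N)=\det(x_i^{\lambda_j+N-j})_{1\le i,j\le N}/\det(x_i^{N-j})_{1\le i,j\le N}$. *)

(* Defs.v *)
From HB Require Import structures.
From mathcomp Require Import all_boot all_order all_fingroup all_algebra.
From mathcomp Require Export reals complex mpoly.

Set Implicit Arguments.
Unset Strict Implicit.
Unset Printing Implicit Defensive.

Import GRing.Theory.
Local Open Scope ring_scope.

Section WreathDeterminant.
Variables (F : fieldType) (A : comAlgType F).

(* [porbits w] contains the singleton cycles of the fixed points of [w]. *)
Definition ncycles N (w : 'S_N) : nat := #|porbits w|.

Definition detk (k : nat) N (B : 'M[A]_N) : A :=
  \sum_(w : 'S_N)
    ((- (k%:R)^-1) ^+ (N - ncycles w) : F) *: \prod_(j < N) B (w j) j.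

Lemma colblock_subproof k n (j : 'I_(k * n)) : (j %/ k < n)%N.
Proof.
case: k j => [|k] j; first by case: j.
by rewrite ltn_divLR // (mulnC n); apply: ltn_ord.
Qed.

Definition colblock k n (j : 'I_(k * n)) : 'I_n :=
  Ordinal (colblock_subproof j).

Definition colrep k m n (M : 'M[A]_(m, n)) : 'M[A]_(m, k * n) :=
  \matrix_(i, j) M i (colblock j).

Definition wrdet k n (M : 'M[A]_(k * n, n)) : A := detk k (colrep k M).

(* Indices are 0-based: column [j] carries the exponent [n - (j + 1)]. *)
Definition wrV n k (x : 'I_(k * n) -> A) : 'M[A]_(k * n, n) :=
  \matrix_(i, j) x i ^+ (n - j.+1).

Definition wrD n k (x : 'I_(k * n) -> A) (a : 'X_{1..k * n}) : A :=
  detk k (\matrix_(i, j) x i ^+ a j).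

End WreathDeterminant.

Definition delta n k : 'X_{1..k * n} :=
  [multinom (n - 1 - j %/ k)%N | j < k * n].

(* A partition of depth at most [N], padded by zeros to length [N], is an
   exponent vector with weakly decreasing entries; its weight is [mdeg]. *)
Definition is_part N (mu : 'X_{1..N}) : bool :=
  [forall i : 'I_N, forall j : 'I_N, (i <= j)%N ==> (mu j <= mu i)%N].

Definition dominated N (mu la : 'X_{1..N}) : bool :=
  [forall r : 'I_N.+1,
    (\sum_(i < N | (i < r)%N) mu i <= \sum_(i < N | (i < r)%N) la i)%N].

(* The cell [Tagged _ j] with tag [i] lies in row [i] and column [j]. *)
Definition cell N (la : 'X_{1..N}) : finType := {i : 'I_N & 'I_(la i)}.

Definition row_of N (la : 'X_{1..N}) (c : cell la) : nat := tag c.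
Definition col_of N (la : 'X_{1..N}) (c : cell la) : nat := tagged c.

Definition semistandard N (la : 'X_{1..N}) (T : {ffun cell la -> 'I_N}) :=
  [forall c : cell la, forall d : cell la,
    ((row_of c == row_of d) && (col_of c <= col_of d)%N ==> (T c <= T d)%N)
    && ((row_of c < row_of d)%N && (col_of c == col_of d) ==> (T c < T d)%N)].

Definition has_weight N (la mu : 'X_{1..N}) (T : {ffun cell la -> 'I_N}) :=
  [forall v : 'I_N, #|[set c | T c == v]| == mu v].

(* A tableau of weight [mu] has all its entries among the [N] letters that
   index [mu], so fillings with values in ['I_N] give all of them. *)
Definition kostka N (la mu : 'X_{1..N}) : nat :=
  #|[set T : {ffun cell la -> 'I_N} | semistandard T && has_weight mu T]|.

Definition stab N (mu : 'X_{1..N}) : {set 'S_N} :=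
  [set s : 'S_N | [forall i, mu (s i) == mu i]].

(* The cosets {t o s : t \in stab mu}. Since [(s * t) i = t (s i)], these right
   cosets for the composition of maps are the left cosets [s *: stab mu]. *)
Definition stab_cosets N (mu : 'X_{1..N}) : {set {set 'S_N}} :=
  lcosets (stab mu) [set: 'S_N].

Definition mperm N (mu : 'X_{1..N}) (s : 'S_N) : 'X_{1..N} :=
  [multinom mu (s i) | i < N].

Definition alternant (F : fieldType) N (a : 'X_{1..N}) : {mpoly F[N]} :=
  \det (\matrix_(i < N, j < N) ('X_i : {mpoly F[N]}) ^+ a j).

Definition staircase N : 'X_{1..N} := [multinom (N - i.+1)%N | i < N].

Definition schur (F : fieldType) N (la : 'X_{1..N}) : {fraction {mpoly F[N]}} :=
  FracField.tofrac (alternant F (la + staircase N)%MM)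
    / FracField.tofrac (alternant F (staircase N)).

(* Main.v *)
Require Import Defs.
From HB Require Import structures.
From mathcomp Require Import all_boot all_order all_fingroup all_algebra.
From mathcomp Require Import reals complex mpoly.
From mathcomp Require Import zify ring.

Import GRing.Theory.
Local Open Scope ring_scope.

Set Implicit Arguments.
Unset Strict Implicit.
Unset Printing Implicit Defensive.

(** Write [N = k * n] and [S] for the generating function of the semistandard
    tableaux of shape [la] with letters in ['I_N].

    Each [w]-term of [detk] is a scalar times [\prod_j x_(w j)^(a j)], and a
    symmetric polynomial [p] does not change when its variables are renamed by
    [w]; so in the [w]-term one may write [p] as
    [\sum_m p_m \prod_j x_(w j)^(m j)], and the exponents of the two products
    add up.  As the coefficients [p_m] are the same for every [w], it follows
    that [p * D(a) = \sum_m p_m D(a + m)] ([symmetric_mul_wrD]).  The formula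
    is the case [p = S], [a = delta]: the coefficient [p_m] is then a Kostka
    number, it is constant on the rearrangements of [m], and each orbit of
    rearrangements consists of one partition [mu] permuted by the
    representatives of its stabilizer cosets ([sum_orbit]).  Only [mu]
    dominated by [la] contribute, because a letter of row [i] of a semistandard
    tableau is at least [i] ([kostka_dominated]).

    What remains is to identify [S] with the quotient of alternants that
    defines the Schur function, and to show that [wrdet V] is nonzero.

    The identification [bialternant_formula] goes by induction on the number of
    variables.  Removing the cells with the largest letter gives the branching
    rule [S_la(x_0..x_m) = \sum_mu x_m^(|la| - |mu|) S_mu(x_0..x_(m-1))] over
    the [mu] that interlace [la].  Alternants satisfy the same rule up to the
    factor [\prod_i (x_i - x_m)] ([shifted_alternant_branching]): subtracting
    from each column a multiple of the next one clears the last row, the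
    entries left are [x_i - x_m] times a finite geometric sum, and expanding
    the determinant along these sums, one summation index for each column,
    yields precisely the interlacing [mu].  The chains of interlacing
    partitions so obtained are Gelfand-Tsetlin patterns, and they are matched
    with tableaux by counting, in each row, the cells with small letters
    ([tableau_sum_eq_pattern_sum]).  The symmetry of [S] is then a consequence:
    [S] is a quotient of two alternating polynomials.

    For the nonvanishing, the coefficient of [x^delta] in [wrdet V] is the sum of
    [(-1/k)^(N - ncycles w)] over the permutations [w] that preserve the [n]
    blocks of equal columns.  Now [(-1/k)^(N - ncycles w)] is [k^-N] times the
    sign of [w] times the number of maps [f : 'I_N -> 'I_k] fixed by [w], and
    exchanging the two sums gives, for each [f], the sum of the signs over the
    stabilizer of [f] in the block group.  That is 1 if [f] is injective on
    every block and 0 otherwise.  So the coefficient is [k^-N] times a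
    positive number. *)

(** * Branching of alternants *)

Lemma telescoping_powers (R : comNzRingType) (x y : R) a b B :
  (a <= b)%N -> (b <= B)%N ->
  (x - y) * \sum_(c < B.+1 | (a <= c <= b)%N) x ^+ c * y ^+ (b - c)
    = x ^+ b.+1 - y ^+ (b.+1 - a) * x ^+ a.
Proof.
move=> ab bB.
have -> : \sum_(c < B.+1 | (a <= c <= b)%N) x ^+ c * y ^+ (b - c)
    = \sum_(a <= c < b.+1) x ^+ c * y ^+ (b - c).
  rewrite (big_nat_widen _ _ B.+1) // big_geq_mkord; apply: eq_bigl => c.
  by rewrite ltnS andbC.
elim: b ab bB => [|b IH] ab bB.
  have -> : a = 0%N by lia.
  by rewrite big_nat1; ring.
case: (ltnP b a) => [ba|ab'].
  have -> : a = b.+1 by apply/eqP; rewrite eqn_leq ab ba.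
  by rewrite big_nat1 subnn subSnn !exprS; ring.
rewrite big_nat_recr //= subnn.
have -> : \sum_(a <= c < b.+1) x ^+ c * y ^+ (b.+1 - c)
    = y * \sum_(a <= c < b.+1) x ^+ c * y ^+ (b - c).
  rewrite big_distrr /=; apply: eq_big_nat => c /andP[_ cb].
  by rewrite subSn // exprS; ring.
rewrite mulrDr mulrCA (IH ab' (ltnW bB)).
rewrite [(b.+2 - a)%N]subSn ?leqW // !exprS expr0.
rewrite [(b.+1 - a)%N]subSn // !exprS; ring.
Qed.

(** Column operations clear the last row except for its last entry, so the
    expansion along that row has a single term. *)
Lemma det_sub_next_column (R : comNzRingType) m (M : 'M[R]_m.+1) (u : nat -> R) :
  (forall j : 'I_m,
     M ord_max (widen_ord (leqnSn m) j) = u j * M ord_max (lift ord0 j)) ->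
  \det M = M ord_max ord_max *
    \det (\matrix_(i < m, j < m)
      (M (widen_ord (leqnSn m) i) (widen_ord (leqnSn m) j)
        - u j * M (widen_ord (leqnSn m) i) (lift ord0 j))).
Proof.
move=> hu.
(* Right multiplication by [U] subtracts [u j] times column [j + 1] from column [j]. *)
pose U : 'M[R]_m.+1 := \matrix_(i, j)
  (if i == j then 1 else if i == j.+1 :> nat then - u j else 0).
have dU : \det U = 1.
  rewrite det_trig; first by rewrite big1 // => i _; rewrite mxE eqxx.
  apply/is_trig_mxP => i j ij; rewrite mxE.
  by rewrite -val_eqE /= (ltn_eqF ij) (ltn_eqF (leqW ij)).
have MUw i (j : 'I_m) : (M *m U) i (widen_ord (leqnSn m) j)
    = M i (widen_ord (leqnSn m) j) - u j * M i (lift ord0 j).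
  rewrite mxE (bigD1 (widen_ord (leqnSn m) j)) //= !mxE eqxx mulr1.
  rewrite (bigD1 (lift ord0 j)) /=; last by rewrite -val_eqE /= /bump leq0n; lia.
  rewrite big1 ?addr0.
    rewrite !mxE -val_eqE /= /bump leq0n add1n eqn_leq ltnn /= eqxx.
    by rewrite mulrN mulrC.
  move=> l /andP[l1 l2]; rewrite mxE ifN //.
  by rewrite ifN ?mulr0.
have MUm i : (M *m U) i ord_max = M i ord_max.
  rewrite mxE (bigD1 ord_max) //= mxE eqxx mulr1 big1 ?addr0 // => l lm.
  rewrite mxE (negPf lm) ifN ?mulr0 //.
  by have := ltn_ord l => /=; lia.
rewrite -[\det M]mulr1 -dU -det_mulmx (expand_det_row _ ord_max).
rewrite (bigD1 ord_max) //= big1 ?addr0 ?MUm; last first.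
  move=> j jm.
  have jlt : (j < m)%N.
    by have := ltn_ord j; move: jm; rewrite -val_eqE /=; lia.
  have -> : j = widen_ord (leqnSn m) (Ordinal jlt) by apply: val_inj.
  by rewrite MUw hu subrr mul0r.
congr (_ * _); rewrite /cofactor -signr_odd addnn odd_double expr0 mul1r.
congr (\det _); apply/matrixP => i j; rewrite [LHS]mxE [LHS]mxE.
have e (l : 'I_m) : lift ord_max l = widen_ord (leqnSn m) l.
  by apply: val_inj; rewrite /= /bump leqNgt ltn_ord.
by rewrite !e MUw mxE.
Qed.

Lemma det_scale_rows (R : comNzRingType) m (d : nat -> R) (M : 'M[R]_m) :
  \det (\matrix_(i, j) (d i * M i j)) = (\prod_(i < m) d i) * \det M.
Proof.
have -> : \matrix_(i, j) (d i * M i j) = diag_mx (\row_i d i) *m M.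
  by rewrite mul_diag_mx; apply/matrixP => i j; rewrite !mxE.
rewrite det_mulmx det_diag; congr (_ * _); apply: eq_bigr => i _.
by rewrite mxE.
Qed.

(** The numerator of the bialternant formula in the first [m] variables.  The
    variables and the parts are indexed by [nat], so that the same [x] and [la]
    serve for every [m] in an induction. *)
Definition shifted_alternant (R : comNzRingType) (x : nat -> R) (m : nat)
    (la : nat -> nat) : R :=
  \det (\matrix_(i < m, j < m) x i ^+ (la j + (m - j.+1))).

(** Rows of length [N] with entries at most [B] form a finite type, over which
    sums can be taken; reading them as sequences that vanish from [N] on
    removes the boundary cases of the interlacing conditions. *)
Definition zext (N B : nat) (f : {ffun 'I_N -> 'I_B.+1}) (j : nat) : nat :=
  oapp (fun i => f i : nat) 0%N (insub j).

Lemma zextE N B (f : {ffun 'I_N -> 'I_B.+1}) (i : 'I_N) : zext f i = f i.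
Proof. by rewrite /zext valK. Qed.

Lemma zext_ge N B (f : {ffun 'I_N -> 'I_B.+1}) j : (N <= j)%N -> zext f j = 0%N.
Proof. by move=> h; rewrite /zext insubF // ltnNge h. Qed.

Lemma zext_lt N B (f : {ffun 'I_N -> 'I_B.+1}) j (h : (j < N)%N) :
  zext f j = f (Ordinal h).
Proof. by rewrite -zextE. Qed.

(** Multilinearity in the columns, with one summation index per column; the
    indices are gathered into a row of fixed length [N], supported on the first
    [m] places, so that the type of [mu] does not depend on [m]. *)
Lemma det_sum_columns (R : comNzRingType) N B m (f : nat -> nat -> nat -> R)
  (Q : nat -> pred nat) : (m <= N)%N ->
  \det (\matrix_(i < m, j < m) \sum_(c < B.+1 | Q j c) f i j c) =
  \sum_(mu in pfamily (ord0 : 'I_B.+1) (fun j : 'I_N => (j < m)%N)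
           (fun (j : 'I_N) (c : 'I_B.+1) => Q j c))
     \det (\matrix_(i < m, j < m) f i j (zext mu j)).
Proof.
move=> mN; rewrite -det_tr /determinant.
transitivity (\sum_(mu in pfamily (ord0 : 'I_B.+1) (fun j : 'I_N => (j < m)%N)
    (fun (j : 'I_N) (c : 'I_B.+1) => Q j c)) \sum_(s : 'S_m)
    (-1) ^+ s * \prod_(i < m) f (s i) i (zext mu i)); last first.
  apply: eq_bigr => mu _; rewrite -[RHS]det_tr; apply: eq_bigr => s _.
  by congr (_ * _); apply: eq_bigr => i _; rewrite !mxE.
rewrite exchange_big /=; apply: eq_bigr => s _; rewrite -big_distrr /=.
congr (_ * _).
(* The product over columns is about to range over ['I_N], so [s] is extended. *)
pose sn (j : nat) : nat := oapp (fun i : 'I_m => s i : nat) 0%N (insub j).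
have snE (j : 'I_m) : sn j = s j by rewrite /sn valK.
pose F (j : nat) (g : nat -> nat) := f (sn j) j (g j).
under eq_bigr => i _.
  rewrite !mxE.
  under eq_bigr => c _ do rewrite -snE.
  over.
rewrite (big_ord_widen N (fun j : nat => \sum_(c < B.+1 | Q j c) f (sn j) j c)) //.
rewrite (big_distr_big_dep (ord0 : 'I_B.+1) (fun j : 'I_N => (j < m)%N)
  (fun (j : 'I_N) (c : 'I_B.+1) => Q j c)) /=.
apply: eq_bigr => mu _.
under [RHS]eq_bigr => i _ do rewrite -snE.
rewrite (big_ord_widen N (fun j : nat => f (sn j) j (zext mu j))) //.
by apply: eq_bigr => j _; rewrite zextE.
Qed.

Lemma det_scale_columns (R : comNzRingType) m (d : nat -> R) (M : 'M[R]_m) :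
  \det (\matrix_(i, j) (d j * M i j)) = (\prod_(i < m) d i) * \det M.
Proof.
rewrite -det_tr -[\det M]det_tr -det_scale_rows; congr (\det _).
by apply/matrixP => i j; rewrite !mxE.
Qed.

(** With [l'_j = l j + m - j], column [j] minus [x_m^(l'_j - l'_(j+1))] times
    column [j + 1] vanishes in row [m]; in row [i] it is [x_i - x_m] times a
    geometric sum whose terms are indexed by [l (j+1) <= c <= l j].  The
    conditions on the different columns are independent, and together they say
    that the row of the indices [c] interlaces [l]. *)
Lemma shifted_alternant_branching (R : comNzRingType) (x : nat -> R)
  N B m (la : {ffun 'I_N -> 'I_B.+1}) (l := zext la) : (m <= N)%N ->
  (forall j, l j.+1 <= l j)%N ->
  shifted_alternant x m.+1 l =
   (\prod_(i < m) (x i - x m)) *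
   \sum_(mu in pfamily (ord0 : 'I_B.+1) (fun j : 'I_N => (j < m)%N)
           (fun (j : 'I_N) (c : 'I_B.+1) => l j.+1 <= c <= l j)%N)
     (x m ^+ l m * \prod_(j < m) x m ^+ (l j - zext mu j)) * 
      shifted_alternant x m (zext mu).
Proof.
move=> mN dl.
rewrite /shifted_alternant.
rewrite (det_sub_next_column (u := fun j => x m ^+ ((l j - l j.+1).+1))); last first.
  move=> j; rewrite !mxE /= -exprD; congr (_ ^+ _).
  have := dl j; have := ltn_ord j; rewrite /bump leq0n add1n; lia.
rewrite !mxE /= subnn addn0.
have -> : \matrix_(i < m, j < m)
   ((\matrix_(i0 < m.+1, j0 < m.+1) x i0 ^+ (l j0 + (m.+1 - j0.+1)))
      (widen_ord (leqnSn m) i) (widen_ord (leqnSn m) j) -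
    x m ^+ (l j - l j.+1).+1 *
    (\matrix_(i0 < m.+1, j0 < m.+1) x i0 ^+ (l j0 + (m.+1 - j0.+1)))
      (widen_ord (leqnSn m) i) (lift ord0 j)) =
  \matrix_(i < m, j < m) ((x i - x m) *
    (\matrix_(i < m, j < m) \sum_(c < B.+1 | (l j.+1 <= c <= l j)%N)
       x i ^+ c * x m ^+ (l j - c) * x i ^+ (m - j.+1)) i j).
  apply/matrixP => i j; rewrite !mxE -mulr_suml mulrA telescoping_powers //; last first.
    by rewrite /l (zext_lt _ (leq_trans (ltn_ord j) mN)) -ltnS.
  rewrite mulrBl -exprD /= /bump leq0n add1n subSS.
  rewrite -mulrA -exprD; congr (_ - _ * _).
    by congr (_ ^+ _); have := ltn_ord j; lia.
  by rewrite subSn //; congr (_ ^+ _).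
rewrite (det_scale_rows (fun i => x i - x m)) mulrCA; congr (_ * _).
rewrite (det_sum_columns (N := N) B
   (fun i j c => x i ^+ c * x m ^+ (l j - c) * x i ^+ (m - j.+1))
   (fun j c => (l j.+1 <= c <= l j)%N)) //.
rewrite big_distrr /=; apply: eq_bigr => mu _; rewrite -mulrA; congr (_ * _).
rewrite -(det_scale_columns (fun j => x m ^+ (l j - zext mu j))).
congr (\det _); apply/matrixP => i j; rewrite !mxE exprD; ring.
Qed.

(** * Gelfand-Tsetlin patterns *)

Definition zero_row N B : {ffun 'I_N -> 'I_B.+1} := [ffun => ord0].

Definition interlaces N B (mu la : {ffun 'I_N -> 'I_B.+1}) : bool :=
  [forall i : 'I_N, (zext la i.+1 <= mu i <= la i)%N].

(** Row [r] of a pattern is the shape formed by the letters smaller than [r],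
    so a pattern has one row more than there are letters. *)
Definition pattern N B := {ffun 'I_N.+1 -> {ffun 'I_N -> 'I_B.+1}}.

Definition row_below N B (P : pattern N B) (r : 'I_N) := P (widen_ord (leqnSn N) r).
Definition row_above N B (P : pattern N B) (r : 'I_N) := P (lift ord0 r).

(** The rows from [m] on are frozen at [la].  In this way the patterns with [m]
    letters, for all [m <= N], live in the same finite type, and removing the
    largest letter is a modification of the rows above it. *)
Definition is_pattern N B m (la : {ffun 'I_N -> 'I_B.+1}) (P : pattern N B) : bool :=
  [&& P ord0 == zero_row N B,
      [forall r : 'I_N, interlaces (row_below P r) (row_above P r)]
    & [forall r : 'I_N.+1, (m <= r)%N ==> (P r == la)]].

Definition row_size N B (la : {ffun 'I_N -> 'I_B.+1}) : nat := (\sum_(i < N) la i)%N.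

Definition pattern_weight (R : comNzRingType) (x : nat -> R) N B (P : pattern N B) : R :=
  \prod_(r < N) x r ^+ (row_size (row_above P r) - row_size (row_below P r)).

Definition pattern_sum (R : comNzRingType) (x : nat -> R) N B m
    (la : {ffun 'I_N -> 'I_B.+1}) : R :=
  \sum_(P | is_pattern m la P) pattern_weight x P.

Lemma interlacesP N B (mu la : {ffun 'I_N -> 'I_B.+1}) :
  reflect (forall j : nat, zext la j.+1 <= zext mu j <= zext la j)%N (interlaces mu la).
Proof.
apply: (iffP forallP) => [h j|h i]; last by have := h i; rewrite !zextE.
have [jN|jN] := ltnP j N; last by rewrite !zext_ge // ltnW.
by rewrite !(zext_lt _ jN); apply: (h (Ordinal jN)).
Qed.

Lemma interlaces_refl N B (la : {ffun 'I_N -> 'I_B.+1}) :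
  (forall j, zext la j.+1 <= zext la j)%N -> interlaces la la.
Proof. by move=> h; apply/interlacesP => j; rewrite h leqnn. Qed.

Lemma interlaces_noninc N B (mu la : {ffun 'I_N -> 'I_B.+1}) :
  interlaces mu la -> (forall j, zext mu j.+1 <= zext mu j)%N.
Proof.
move=> /interlacesP h j; have /andP[_ h1] := h j.+1; have /andP[h2 _] := h j.
exact: leq_trans h1 h2.
Qed.

(** Patterns are grouped by their row [m].  Refreezing the rows above [m] at
    that row, instead of at [la], is a bijection onto the patterns with one
    letter less, and it removes from the weight only the power of [x m]. *)
Lemma pattern_sum_branching (R : comNzRingType) (x : nat -> R) N B m
    (la : {ffun 'I_N -> 'I_B.+1}) : (m < N)%N ->
  (forall j, zext la j.+1 <= zext la j)%N ->
  pattern_sum x m.+1 la =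
  \sum_(mu | interlaces mu la)
    x m ^+ (row_size la - row_size mu) * pattern_sum x m mu.
Proof.
move=> mN dla; pose om : 'I_N := Ordinal mN.
rewrite /pattern_sum.
rewrite (partition_big (fun P => row_below P om) (fun mu => interlaces mu la)) /=;
  last first.
  move=> P /and3P[_ /forallP/(_ om) + /forallP/(_ (lift ord0 om))].
  by rewrite /row_above /= leqnn => ? /eqP<-.
apply: eq_bigr => mu mula.
pose h (P : pattern N B) : pattern N B :=
  [ffun r : 'I_N.+1 => if (r <= m)%N then P r else la].
pose h' (P : pattern N B) : pattern N B :=
  [ffun r : 'I_N.+1 => if (r <= m)%N then P r else mu].
rewrite (reindex_onto h h') /=; last first.
  move=> P /andP[/and3P[_ _ /forallP hP] _]; apply/ffunP => r; rewrite !ffunE.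
  by case: (leqP r m) => // mr; have := hP r; rewrite mr /= => /eqP.
rewrite big_distrr /=.
have belowh (P : pattern N B) r :
    row_below (h P) r = if (r <= m)%N then row_below P r else la.
  by rewrite /row_below ffunE.
have aboveh (P : pattern N B) r :
    row_above (h P) r = if (r < m)%N then row_above P r else la.
  by rewrite /row_above ffunE /= /bump leq0n add1n.
have hw (P : pattern N B) : is_pattern m mu P -> 
   pattern_weight x (h P) = x m ^+ (row_size la - row_size mu) * pattern_weight x P.
  move=> /and3P[_ _ /forallP hP]; rewrite /pattern_weight.
  have above_mu (r : 'I_N) : (m <= r)%N -> row_above P r = mu.
    by move=> mr; have := hP (lift ord0 r); rewrite /= /bump leq0n leqW //= => /eqP.
  have below_mu (r : 'I_N) : (m <= r)%N -> row_below P r = mu.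
    by move=> mr; have := hP (widen_ord (leqnSn N) r); rewrite /= mr /= => /eqP.
  rewrite (bigD1 om) //= [X in _ = _ * X](bigD1 om) //= belowh aboveh leqnn ltnn.
  rewrite above_mu // below_mu // subnn expr0 mul1r; congr (_ * _).
  apply: eq_bigr => r rm; rewrite belowh aboveh.
  have [rm1|rm1|rm1] := ltngtP r m; first by [].
    by rewrite !above_mu ?below_mu ?(ltnW rm1) // !subnn.
  by move: rm; rewrite -val_eqE /= rm1 eqxx.
have hc (P : pattern N B) :
    is_pattern m.+1 la (h P) && (row_below (h P) om == mu) && (h' (h P) == P)
    = is_pattern m mu P.
  rewrite belowh leqnn; apply/idP/idP.
    move=> /andP[/andP[/and3P[h0 /forallP hi _] /eqP Pm] /eqP hP].
    have Pmu (r : 'I_N.+1) : (m <= r)%N -> P r = mu.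
      rewrite leq_eqVlt => /predU1P[mr|mr].
        by rewrite -Pm; congr (P _); apply: val_inj; rewrite /= mr.
      by rewrite -hP !ffunE leqNgt mr.
    apply/and3P; split.
    - by move: h0; rewrite ffunE.
    - apply/forallP => r; have [rm|mr] := ltnP r m.
        by have := hi r; rewrite belowh aboveh rm (ltnW rm).
      rewrite /row_below /row_above !Pmu //; last by rewrite /= /bump leq0n leqW.
      exact/interlaces_refl/(interlaces_noninc mula).
    - by apply/forallP => r; apply/implyP => /Pmu ->.
  move=> /and3P[h0 /forallP hi /forallP hP].
  have Pmu (r : 'I_N.+1) : (m <= r)%N -> P r = mu.
    by move=> mr; have := hP r; rewrite mr => /eqP.
  rewrite /row_below Pmu //= eqxx andbT; apply/andP; split; last first.
    apply/eqP/ffunP => r; rewrite !ffunE; case: leqP => // mr.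
    by rewrite Pmu // ltnW.
  apply/and3P; split.
  - by rewrite ffunE.
  - apply/forallP => r; rewrite belowh aboveh.
    have [rm|mr|rm] := ltngtP r m; first exact: hi.
      exact: interlaces_refl.
    by rewrite /row_below Pmu //= rm.
  - by apply/forallP => r; apply/implyP => mr; rewrite ffunE leqNgt mr.
by apply: eq_big => [|P]; [exact: hc|rewrite hc; exact: hw].
Qed.

(** Shapes with [r] letters have at most [r] rows: interlacing pushes the zero
    row at the bottom one place to the right for each letter. *)
Lemma pattern_zero_above_diagonal N B m (la : {ffun 'I_N -> 'I_B.+1}) (P : pattern N B) :
  is_pattern m la P -> forall r : 'I_N.+1, forall j, (r <= j)%N -> zext (P r) j = 0%N.
Proof.
move=> /and3P[/eqP P0 /forallP hP _] [r rN].
elim: r rN => [|r IH] rN j rj.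
  have -> : Ordinal rN = ord0 by apply: val_inj.
  rewrite P0; have [jN|jN] := ltnP j N; last by rewrite zext_ge.
  by rewrite (zext_lt _ jN) ffunE.
case: j rj => // j rj.
have := hP (Ordinal (rN : r < N)%N) => /interlacesP/(_ j)/andP[+ _].
rewrite /row_below /row_above.
have -> : widen_ord (leqnSn N) (Ordinal (rN : (r < N)%N)) = Ordinal (ltnW rN).
  exact: val_inj.
have -> : lift ord0 (Ordinal (rN : (r < N)%N)) = Ordinal rN by apply: val_inj.
by rewrite IH // leqn0 => /eqP.
Qed.

Lemma pattern_sum_eq0 (R : comNzRingType) (x : nat -> R) N B m
    (la : {ffun 'I_N -> 'I_B.+1}) j :
  (m <= j)%N -> (m <= N)%N -> zext la j != 0%N -> pattern_sum x m la = 0.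
Proof.
move=> mj mN nz; rewrite /pattern_sum big_pred0 // => P; apply/negP => hP.
have mN1 : (m < N.+1)%N by [].
have /and3P[_ _ /forallP/(_ (Ordinal mN1))] := hP; rewrite leqnn /= => /eqP Pm.
by move: nz; rewrite -Pm (pattern_zero_above_diagonal hP).
Qed.

Lemma zext0 N B j : zext (zero_row N B) j = 0%N.
Proof. by rewrite /zext; case: insub => //= i; rewrite ffunE. Qed.

Lemma pattern_sum0 (R : comNzRingType) (x : nat -> R) N B :
  pattern_sum x 0 (zero_row N B) = 1 :> R.
Proof.
rewrite /pattern_sum (big_pred1 [ffun => zero_row N B]).
  by rewrite /pattern_weight big1 // => r _; rewrite /row_above /row_below !ffunE subnn.
move=> P; apply/idP/eqP => [/and3P[_ _ /forallP hP]|->].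
  by apply/ffunP => r; rewrite ffunE; apply/eqP/hP.
apply/and3P; split; first by rewrite ffunE.
  apply/forallP => r; rewrite /row_above /row_below !ffunE.
  by apply: interlaces_refl => j; rewrite !zext0.
by apply/forallP => r; rewrite ffunE eqxx implybT.
Qed.

Lemma row_sizeE N B m (la : {ffun 'I_N -> 'I_B.+1}) : (m <= N)%N ->
  (forall j, (m <= j)%N -> zext la j = 0%N) ->
  row_size la = (\sum_(j < m) zext la j)%N.
Proof.
move=> mN h; rewrite (big_ord_widen N (zext la)) // /row_size.
rewrite [RHS]big_mkcond /=; apply: eq_bigr => i _; rewrite zextE.
by case: ltnP => // /h; rewrite zextE.
Qed.

Lemma shifted_alternant0S (R : comNzRingType) (x : nat -> R) m :
  shifted_alternant x m.+1 (fun=> 0%N) =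
  (\prod_(i < m) (x i - x m)) * shifted_alternant x m (fun=> 0%N).
Proof.
have e p (l : nat -> nat) : (forall j, l j = 0%N) ->
    shifted_alternant x p l = shifted_alternant x p (fun=> 0%N).
  by move=> h; congr (\det _); apply/matrixP => i j; rewrite !mxE h.
rewrite -(e m.+1 (zext (zero_row m 0))); last exact: zext0.
rewrite shifted_alternant_branching //; last by move=> j; rewrite !zext0.
congr (_ * _); rewrite (big_pred1 (zero_row m 0)).
  rewrite zext0 expr0 mul1r big1 ?mul1r; last by move=> i _; rewrite zext0 expr0.
  by rewrite e //; apply: zext0.
move=> mu /=; apply/idP/eqP => [_|->]; last first.
  apply/pfamilyP; split; first by apply/supportP => i; rewrite ffunE.
  by move=> i _; rewrite -topredE /= !zext0 ffunE.
by apply/ffunP => i; rewrite ffunE; apply/val_inj; case: (mu i) => -[].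
Qed.

(** Both sides satisfy the same branching rule.  The patterns interlacing [la]
    with a part beyond the first [m] contribute nothing, which leaves exactly
    the rows that occur in the expansion of the alternant. *)
Lemma alternant_mul_pattern_sum (R : comNzRingType) (x : nat -> R) N B m
    (la : {ffun 'I_N -> 'I_B.+1}) : (m <= N)%N ->
  (forall j, zext la j.+1 <= zext la j)%N ->
  (forall j, (m <= j)%N -> zext la j = 0%N) ->
  shifted_alternant x m (fun=> 0%N) * pattern_sum x m la = shifted_alternant x m (zext la).
Proof.
elim: m la => [|m IH] la mN dla hla.
  have -> : la = zero_row N B.
    by apply/ffunP => i; apply/val_inj; rewrite -[LHS]zextE hla // ffunE.
  by rewrite pattern_sum0 /shifted_alternant !det_mx00 mulr1.
rewrite shifted_alternant_branching ?(ltnW mN) // shifted_alternant0S -mulrA.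
congr (_ * _); rewrite pattern_sum_branching // big_distrr /=.
rewrite (bigID (fun mu : {ffun 'I_N -> 'I_B.+1} =>
  [forall j : 'I_N, (m <= j)%N ==> (mu j == ord0)])) /=.
rewrite [X in _ + X]big1 ?addr0; last first.
  move=> mu /andP[_ /forallPn[j]]; rewrite negb_imply => /andP[mj nz].
  by rewrite (pattern_sum_eq0 _ mj) ?(ltnW mN) ?mulr0 // zextE.
apply: eq_big => [mu|mu /andP[mula /forallP mu0]].
  apply/andP/pfamilyP => [[/forallP hi /forallP h0]|[/supportP hs hi]].
    split; last by move=> i _; rewrite -topredE /= (zextE la i); apply: hi.
    by apply/supportP => i; rewrite -leqNgt => mi; apply/eqP; have := h0 i; rewrite mi.
  split; apply/forallP => i; last first.
    by apply/implyP => mi; rewrite hs //; rewrite -leqNgt.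
  have [im|mi] := ltnP i m; first by have := hi i im; rewrite -topredE /= (zextE la i).
  by rewrite hs ?leq0n ?andbT ?hla // -leqNgt.
have mu0' j : (m <= j)%N -> zext mu j = 0%N.
  move=> mj; have [jN|jN] := ltnP j N; last by rewrite zext_ge.
  by have := mu0 (Ordinal jN); rewrite mj (zext_lt _ jN) => /eqP ->.
rewrite -(IH mu) ?(ltnW mN) //; last exact: interlaces_noninc mula.
rewrite mulrCA; congr (_ * _).
rewrite prodrXr -exprD; congr (_ ^+ _).
rewrite (row_sizeE mN hla) (row_sizeE (ltnW mN) mu0') big_ord_recr /=.
rewrite sumnB; last by move=> i _; have /interlacesP/(_ i)/andP[] := mula.
have : (\sum_(i < m) zext mu i <= \sum_(i < m) zext la i)%N.
  by apply: leq_sum => i _; have /interlacesP/(_ i)/andP[] := mula.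
by move=> h; rewrite [X in (X - _)%N]addnC addnBA.
Qed.

(** * Tableaux and patterns *)

(** A downset of ['I_n] is an initial segment, so it is determined by its
    cardinality.  This turns the counts that define the two maps between
    tableaux and patterns back into inequalities. *)
Lemma card_downset n (p : pred 'I_n) :
  (forall i j : 'I_n, (i <= j)%N -> p j -> p i) ->
  forall j : 'I_n, (j < #|[set i | p i]|)%N = p j.
Proof.
move=> down.
suff [c cn hc] : exists2 c, (c <= n)%N & forall j : 'I_n, p j = (j < c)%N.
  move=> j; rewrite hc; congr (_ < _)%N.
  rewrite -sum1dep_card (eq_bigl (fun i : 'I_n => i < c)%N) //.
  by rewrite (big_ord_narrow cn) sum1_card card_ord.
have [/forallP all_p|/forallPn[i0 ni0]] := boolP [forall i, p i].
  by exists n => // j; rewrite all_p ltn_ord.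
(* The least element outside the downset is its cardinality. *)
pose i1 := [arg min_(i < i0 | ~~ p i) (i : nat)].
have [ni1 hi1] : ~~ p i1 /\ forall j, ~~ p j -> (i1 <= j)%N.
  by rewrite /i1; case: arg_minnP.
exists i1; first exact: ltnW.
move=> j; apply/idP/idP => [pj|].
  by rewrite ltnNge; apply/negP => /down/(_ pj); apply/negP.
by apply: contraLR => /hi1; rewrite -leqNgt.
Qed.

Lemma eq_of_ltn n a b : (a <= n)%N -> (b <= n)%N ->
  (forall j : 'I_n, (j < a)%N = (j < b)%N) -> a = b.
Proof.
move=> an bn h; apply/eqP; rewrite eqn_leq; apply/andP; split; rewrite leqNgt; apply/negP.
  by move=> ba; have := h (Ordinal (leq_trans ba an)); rewrite /= ba ltnn.
by move=> ab; have := h (Ordinal (leq_trans ab bn)); rewrite /= ab ltnn.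
Qed.

Definition cell_at N (la : 'X_{1..N}) (i : 'I_N) (j : 'I_(la i)) : cell la :=
  Tagged (fun i : 'I_N => 'I_(la i)) j.

Definition shape_row N (la : 'X_{1..N}) : {ffun 'I_N -> 'I_(mdeg la).+1} :=
  [ffun i => inord (la i)].

Lemma leq_mdeg N (la : 'X_{1..N}) i : (la i <= mdeg la)%N.
Proof. by rewrite mdegE (bigD1 i) //= leq_addr. Qed.

Lemma shape_rowE N (la : 'X_{1..N}) i : shape_row la i = la i :> nat.
Proof. by rewrite ffunE inordK // ltnS leq_mdeg. Qed.

Lemma shape_row_noninc N (la : 'X_{1..N}) : is_part la ->
  forall j, (zext (shape_row la) j.+1 <= zext (shape_row la) j)%N.
Proof.
move=> /forallP hla j; have [jN|jN] := ltnP j.+1 N; last by rewrite zext_ge.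
rewrite (zext_lt _ jN) (zext_lt _ (ltnW jN)) !shape_rowE.
by have /forallP/(_ (Ordinal jN)) := hla (Ordinal (ltnW jN)); rewrite /= leqnSn.
Qed.

Definition tableau_weight (R : comNzRingType) (x : nat -> R) N (la : 'X_{1..N})
   (T : {ffun cell la -> 'I_N}) : R := \prod_c x (T c).

Definition count_small N (la : 'X_{1..N}) (T : {ffun cell la -> 'I_N}) (r : nat) (i : 'I_N) :=
  #|[set j : 'I_(la i) | (T (cell_at j) < r)%N]|.

Definition pattern_of N (la : 'X_{1..N}) (T : {ffun cell la -> 'I_N}) : pattern N (mdeg la) :=
  [ffun r : 'I_N.+1 => [ffun i : 'I_N => inord (count_small T r i)]].

(** For a pattern the letter in cell [(i, j)] is the number of rows [r >= 1]
    that do not yet cover this cell, which is the least [r] such that row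
    [r + 1] covers it.  The type ['I_N] may be empty,
    so the default value has to come from the cell: [tag c] is its row. *)
Definition tableau_of N (la : 'X_{1..N}) (P : pattern N (mdeg la)) : {ffun cell la -> 'I_N} :=
  [ffun c : cell la => insubd (tag c)
     #|[set r : 'I_N | (row_above P r (tag c) <= col_of c)%N]|].

Section TableauPattern.
Variables (N : nat) (la : 'X_{1..N}).
Hypothesis hla : is_part la.
Implicit Types (T : {ffun cell la -> 'I_N}) (P : pattern N (mdeg la)).

Lemma count_small_le T r i : (count_small T r i <= la i)%N.
Proof. by rewrite -[leqRHS]card_ord; apply: max_card. Qed.

Lemma pattern_ofE T r i : pattern_of T r i = count_small T r i :> nat.
Proof.
by rewrite !ffunE inordK // ltnS (leq_trans (count_small_le _ _ _)) ?leq_mdeg.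
Qed.

Lemma semistandard_row T i (j j' : 'I_(la i)) :
  semistandard T -> (j <= j')%N -> (T (cell_at j) <= T (cell_at j'))%N.
Proof.
move=> /forallP/(_ (cell_at j))/forallP/(_ (cell_at j'))/andP[/implyP + _] jj.
by rewrite /row_of /col_of /= eqxx jj; apply.
Qed.

Lemma semistandard_column T i i' (j : 'I_(la i)) (j' : 'I_(la i')) :
  semistandard T -> (i < i')%N -> j = j' :> nat ->
  (T (cell_at j) < T (cell_at j'))%N.
Proof.
move=> /forallP/(_ (cell_at j))/forallP/(_ (cell_at j'))/andP[_ /implyP +] ii jj.
by rewrite /row_of /col_of /= ii jj eqxx; apply.
Qed.

(** Rows of a semistandard tableau increase weakly, so the cells with letters
    below [r] form an initial segment of each row. *)
Lemma ltn_count_small T r i (j : 'I_(la i)) : semistandard T ->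
  (j < count_small T r i)%N = (T (cell_at j) < r)%N.
Proof.
move=> sT; apply: (card_downset (p := fun j => T (cell_at j) < r)%N).
by move=> j1 j2 jj; apply: leq_ltn_trans; apply: semistandard_row.
Qed.

Lemma is_part_le (i i' : 'I_N) : (i <= i')%N -> (la i' <= la i)%N.
Proof. by have /forallP/(_ i)/forallP/(_ i')/implyP := hla. Qed.

(** Interlacing of consecutive rows is column strictness: if the letter below a
    cell is at most [r], the letter in the cell is smaller than [r]. *)
Lemma pattern_ofP T : semistandard T -> is_pattern N (shape_row la) (pattern_of T).
Proof.
move=> sT; apply/and3P; split.
- apply/eqP/ffunP => i; apply/val_inj; rewrite /= pattern_ofE ffunE /=.
  by apply/eqP; rewrite cards_eq0 -subset0; apply/subsetP => j; rewrite inE.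
- apply/forallP => r; apply/forallP => i.
  rewrite /row_below /row_above !pattern_ofE; apply/andP; split; last first.
    apply/subset_leq_card/subsetP => j; rewrite !inE /= /bump leq0n add1n.
    exact: leqW.
  have [iN|iN] := ltnP i.+1 N; last by rewrite zext_ge.
  rewrite (zext_lt _ iN) pattern_ofE leqNgt; apply/negP => lt_c.
  have jla' := leq_trans lt_c (count_small_le _ _ _).
  have jla := leq_trans jla' (is_part_le (i' := Ordinal iN) (leqnSn i)).
  have := ltn_count_small (widen_ord (leqnSn N) r) (Ordinal jla) sT.
  rewrite /= ltnn => /esym/negP; apply.
  move: lt_c; have := ltn_count_small (lift ord0 r) (Ordinal jla') sT.
  rewrite /= => -> ; rewrite /bump leq0n add1n ltnS; apply: leq_trans.
  exact: semistandard_column.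
- apply/forallP => r; apply/implyP => Nr; apply/eqP/ffunP => i.
  apply/val_inj; rewrite /= pattern_ofE shape_rowE /count_small.
  rewrite -[RHS]card_ord; apply: eq_card => j; rewrite !inE.
  exact: leq_trans (ltn_ord _) Nr.
Qed.


Lemma pattern_mono P (r r' : 'I_N.+1) i : is_pattern N (shape_row la) P ->
  (r <= r')%N -> (P r i <= P r' i)%N.
Proof.
move=> /and3P[_ /forallP hP _]; case: r r' => r rN [r' r'N] /= rr'.
elim: r' r'N rr' => [|r' IH] r'N rr'.
  rewrite leq_eqVlt; apply/orP; left; apply/eqP; congr (nat_of_ord (P _ i)).
  by apply: val_inj => /=; lia.
have [e|ne] := eqVneq r r'.+1.
  by rewrite leq_eqVlt; apply/orP; left; apply/eqP; congr (nat_of_ord (P _ i)); apply: val_inj.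
have rr'' : (r <= r')%N.
  by move: rr' ne; rewrite leq_eqVlt ltnS => /predU1P[->|//]; rewrite eqxx.
apply: leq_trans (IH (ltnW r'N) rr'') _.
have := hP (Ordinal (r'N : (r' < N)%N)) => /forallP/(_ i)/andP[_].
rewrite /row_below /row_above.
have -> : widen_ord (leqnSn N) (Ordinal (r'N : (r' < N)%N)) = Ordinal (ltnW r'N).
  exact: val_inj.
by have -> : lift ord0 (Ordinal (r'N : (r' < N)%N)) = Ordinal r'N by apply: val_inj.
Qed.

Lemma pattern_top P i : is_pattern N (shape_row la) P -> P ord_max i = la i :> nat.
Proof.
by move=> /and3P[_ _ /forallP/(_ ord_max)]; rewrite leqnn => /eqP ->; apply: shape_rowE.
Qed.

(** The defining property of the inverse map; a letter is determined by the
    thresholds [r] below which it lies, so everything else about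
    [tableau_of] follows from it. *)
Lemma tableau_of_ltn P (r : 'I_N.+1) i (j : 'I_(la i)) :
  is_pattern N (shape_row la) P ->
  (tableau_of P (cell_at j) < r)%N = (j < P r i)%N.
Proof.
move=> hP.
pose p := [pred r : 'I_N | (row_above P r i <= j)%N].
have down (r1 r2 : 'I_N) : (r1 <= r2)%N -> p r2 -> p r1.
  by move=> rr; apply: leq_trans; apply: pattern_mono => //=; rewrite /bump !leq0n !add1n.
have hp := card_downset down.
have lt_card : (#|[set r | p r]| < N)%N.
  have N0 : (N.-1 < N)%N by have := ltn_ord i; lia.
  rewrite ltnNge; apply/negP => Nc.
  have := hp (Ordinal N0); rewrite (leq_trans N0 Nc) => /esym.
  rewrite /= /row_above.
  have -> : lift ord0 (Ordinal N0) = ord_max.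
    by apply: val_inj; rewrite /= /bump leq0n add1n prednK // (leq_ltn_trans _ N0).
  by rewrite pattern_top // leqNgt ltn_ord.
have vE : tableau_of P (cell_at j) = #|[set r | p r]| :> nat.
  by rewrite ffunE insubdK.
rewrite vE; case: r => -[|r] rN.
  have -> : Ordinal rN = ord0 by apply: val_inj.
  by have /and3P[/eqP -> _ _] := hP; rewrite ffunE.
rewrite /= ltnS leqNgt.
have -> := hp (Ordinal (rN : (r < N)%N)); rewrite /= -ltnNge /row_above.
by have -> : lift ord0 (Ordinal (rN : (r < N)%N)) = Ordinal rN by apply: val_inj.
Qed.

Lemma eq_of_ltn_ord (v w : 'I_N) : (forall r : 'I_N.+1, (v < r)%N = (w < r)%N) -> v = w.
Proof.
move=> h; apply/val_inj/eqP; rewrite eqn_leq.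
have := h (lift ord0 v); have := h (lift ord0 w); rewrite /= /bump !leq0n !add1n !ltnS.
by rewrite !leqnn => -> <-.
Qed.

Lemma pattern_ofK T : semistandard T -> tableau_of (pattern_of T) = T.
Proof.
move=> sT; apply/ffunP => -[i j]; apply: eq_of_ltn_ord => r.
rewrite -[existT _ i j]/(cell_at j) tableau_of_ltn ?pattern_ofP //.
by rewrite pattern_ofE ltn_count_small.
Qed.

Lemma tableau_ofK P : is_pattern N (shape_row la) P -> pattern_of (tableau_of P) = P.
Proof.
move=> hP; apply/ffunP => r; apply/ffunP => i; apply: val_inj; rewrite /= pattern_ofE.
have Pla : (P r i <= la i)%N by rewrite -(pattern_top i hP) pattern_mono // leq_ord.
apply: (eq_of_ltn (count_small_le _ _ _) Pla) => j.
rewrite -(tableau_of_ltn _ j hP).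
apply: (card_downset (p := fun j => tableau_of P (cell_at j) < r)%N).
by move=> j1 j2 jj; rewrite !tableau_of_ltn //; apply: leq_ltn_trans.
Qed.

Lemma tableau_ofP P : is_pattern N (shape_row la) P -> semistandard (tableau_of P).
Proof.
move=> hP; apply/forallP => -[i j]; apply/forallP => -[i' j'].
rewrite /row_of /col_of /= -[existT _ i j]/(cell_at j) -[existT _ i' j']/(cell_at j').
set t := tableau_of P (cell_at j').
apply/andP; split; apply/implyP.
  move=> /andP[/eqP ii jj]; have {}ii : i = i' by apply: val_inj.
  subst i'.
  have := tableau_of_ltn (lift ord0 t) j hP; rewrite /= /bump leq0n add1n ltnS => ->.
  apply: leq_ltn_trans jj _.
  by rewrite -tableau_of_ltn //= /bump leq0n add1n ltnSn.
move=> /andP[ii /eqP jj].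
have := tableau_of_ltn (widen_ord (leqnSn N) t) j hP; rewrite /= => ->.
have lt' : (j' < row_above P t i')%N.
  by rewrite -tableau_of_ltn //= /bump leq0n add1n ltnSn.
rewrite jj; apply: leq_trans lt' _.
have /and3P[_ /forallP/(_ t) ht _] := hP.
(* The rows [i] and [i'] need not be adjacent, so the interlacing condition is iterated. *)
have above_noninc a b : (a <= b)%N -> (zext (row_above P t) b <= zext (row_above P t) a)%N.
  move=> ab; rewrite -(subnK ab); elim: (b - a)%N => // d; apply: leq_trans.
  have /interlacesP/(_ (d + a)%N)/andP[h1 h2] := ht.
  exact: leq_trans h1 h2.
rewrite -[X in (X <= _)%N]zextE.
apply: leq_trans (above_noninc _ _ ii) _.
by have /forallP/(_ i)/andP[] := ht.
Qed.

Lemma row_size_pattern_of T (r : 'I_N.+1) :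
  row_size (pattern_of T r) = #|[set c | (T c < r)%N]|.
Proof.
rewrite /row_size -sum1dep_card.
rewrite (eq_bigr (fun i => \sum_(j < la i | T (cell_at j) < r) 1)%N); last first.
  by move=> i _; rewrite pattern_ofE /count_small -sum1dep_card.
rewrite (sig_big_dep xpredT) /=.
by apply: eq_bigl => -[i j].
Qed.

Lemma pattern_weight_of (R : comNzRingType) (x : nat -> R) T :
  pattern_weight x (pattern_of T) = tableau_weight x T.
Proof.
rewrite /tableau_weight (partition_big (fun c => T c) xpredT) //=.
apply: eq_bigr => r _; rewrite /row_above /row_below !row_size_pattern_of.
rewrite (eq_bigr (fun=> x r)); last by move=> c /eqP ->.
rewrite prodr_const; congr (_ ^+ _).
rewrite -(cardsID [set c | T c < r]%N [set c | T c < lift ord0 r]%N).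
have -> : [set c | T c < lift ord0 r]%N :&: [set c | T c < r]%N = [set c | T c < r]%N.
  by apply/setP => c; rewrite !inE /= /bump leq0n add1n; case: ltngtP; rewrite ?andbF //; lia.
rewrite addKn; apply: eq_card => c.
rewrite !inE /= /bump leq0n add1n ltnS -leqNgt [RHS]unfold_in.
by rewrite -[eqn _ _]/(nat_of_ord (T c) == r) eqn_leq andbC.
Qed.

(** The two maps are mutually inverse and preserve weights, as the cells with
    letter [r] are those added between the rows [r] and [r + 1] of the
    pattern. *)
Lemma tableau_sum_eq_pattern_sum (R : comNzRingType) (x : nat -> R) :
  \sum_(T : {ffun cell la -> 'I_N} | semistandard T) tableau_weight x T
    = pattern_sum x N (shape_row la).
Proof.
rewrite (reindex_onto (@tableau_of N la) (@pattern_of N la)) /=; last first.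
  exact: pattern_ofK.
apply: eq_big => P; last by move=> /andP[_ /eqP e]; rewrite -pattern_weight_of e.
apply/andP/idP => [[sP /eqP <-]|hP]; first exact: pattern_ofP.
by rewrite tableau_ofP // tableau_ofK.
Qed.

End TableauPattern.

(** * The Schur function as a tableau generating function *)

Section SchurPolynomial.
Variables (F : fieldType) (N : nat).
Implicit Types (la mu nu : 'X_{1..N}).

(** The variables as a sequence, to match the indexing of
    [shifted_alternant]. *)
Definition var (i : nat) : {mpoly F[N]} := oapp (fun i : 'I_N => 'X_i) 0 (insub i).

Lemma varE (i : 'I_N) : var i = 'X_i.
Proof. by rewrite /var valK. Qed.

Lemma alternantE la :
  is_part la ->
  alternant F (la + staircase N)%MM = shifted_alternant var N (zext (shape_row la)).
Proof.
move=> hla; congr (\det _); apply/matrixP => i j.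
by rewrite !mxE varE zextE shape_rowE mnmDE mnmE.
Qed.

Lemma alternant_staircaseE : alternant F (staircase N) = shifted_alternant var N (fun=> 0%N).
Proof. by congr (\det _); apply/matrixP => i j; rewrite !mxE varE mnmE. Qed.

Lemma mpolyX_inj : injective (fun i : 'I_N => 'X_i : {mpoly F[N]}).
Proof.
move=> i j /(congr1 (mcoeff U_(i)%MM)); rewrite !mcoeffX eqxx.
case: eqVneq => [/mnmP/(_ i)|_ /eqP]; last by rewrite oner_eq0.
by rewrite !mnm1E eqxx; case: eqVneq.
Qed.

Lemma alternant_staircase_neq0 : alternant F (staircase N) != 0.
Proof.
rewrite alternant_staircaseE.
suff h m : (m <= N)%N -> shifted_alternant var m (fun=> 0%N) != 0 by apply: h.
elim: m => [|m IH] mN; first by rewrite /shifted_alternant det_mx00 oner_eq0.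
rewrite shifted_alternant0S mulf_neq0 ?IH ?(ltnW mN) //.
apply/prodf_neq0 => i _; rewrite subr_eq0.
rewrite (varE (widen_ord (ltnW mN) i)) (varE (Ordinal mN)).
apply/eqP => /mpolyX_inj/(congr1 val)/=; have := ltn_ord i; lia.
Qed.

Definition schur_poly la : {mpoly F[N]} :=
  \sum_(T : {ffun cell la -> 'I_N} | semistandard T) \prod_c 'X_(T c).

Lemma bialternant_formula la : is_part la ->
  alternant F (staircase N) * schur_poly la = alternant F (la + staircase N)%MM.
Proof.
move=> hla; rewrite alternant_staircaseE alternantE //.
rewrite -alternant_mul_pattern_sum //; first last.
- by move=> j Nj; rewrite zext_ge.
- exact: shape_row_noninc.
rewrite -tableau_sum_eq_pattern_sum //; congr (_ * _).
by apply: eq_bigr => T _; apply: eq_bigr => c _; rewrite varE.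
Qed.

Lemma mcoeff_schur_poly la nu : (schur_poly la)@_nu = (kostka la nu)%:R.
Proof.
rewrite /schur_poly raddf_sum /= /kostka -sum1dep_card natr_sum.
rewrite [RHS]big_mkcondr /=; apply: eq_bigr => T _.
have -> : \prod_c 'X_(T c) = 'X_[[multinom #|[set c | T c == v]| | v < N]] :> {mpoly F[N]}.
  rewrite mpolyXE_id (partition_big T xpredT) //=; apply: eq_bigr => v _.
  rewrite (eq_bigr (fun=> 'X_v)); last by move=> c /eqP ->.
  by rewrite prodr_const mnmE cardsE.
rewrite mcoeffX /has_weight.
have -> : ([multinom #|[set c | T c == v]| | v < N] == nu) =
    [forall v : 'I_N, #|[set c | T c == v]| == nu v].
  by apply/eqP/forallP => [<- v|h]; [rewrite mnmE|apply/mnmP => v; rewrite mnmE; apply/eqP].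
by case: ifP.
Qed.

Lemma msym_alternant (s : 'S_N) la :
  msym s (alternant F la) = (-1) ^+ s * alternant F la.
Proof.
rewrite /alternant -det_map_mx -det_perm -det_mulmx -row_permE.
congr (\det _); apply/matrixP => i j.
by rewrite !mxE rmorphXn /= /msym mmapX mmap1U.
Qed.

(** Numerator and denominator of the bialternant formula both change by the
    sign of [s], and the denominator can be cancelled. *)
Lemma schur_poly_sym la : is_part la -> schur_poly la \is symmetric.
Proof.
move=> hla; apply/issymP => s.
apply: (mulfI alternant_staircase_neq0); rewrite bialternant_formula //.
have := congr1 (msym s) (bialternant_formula hla).
rewrite msymM !msym_alternant -mulrA => h.
by apply: (mulfI (_ : (-1) ^+ s != 0)); rewrite ?signr_eq0.
Qed.

Lemma schur_fraction la : is_part la -> schur F la = FracField.tofrac (schur_poly la).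
Proof.
move=> hla; rewrite /schur -bialternant_formula // rmorphM.
by rewrite mulrAC divff ?mul1r // tofrac_eq0 alternant_staircase_neq0.
Qed.

End SchurPolynomial.

(** * Dominance and Kostka numbers *)

Lemma card_cell N (la : 'X_{1..N}) : #|cell la| = mdeg la.
Proof.
rewrite /cell card_tagged sumnE big_map big_enum mdegE /=.
by apply: eq_bigr => i _; rewrite card_ord.
Qed.

Lemma kostka_mdeg N (la mu : 'X_{1..N}) : kostka la mu != 0%N -> mdeg mu = mdeg la.
Proof.
rewrite -lt0n => /card_gt0P[T]; rewrite inE => /andP[_ /forallP hw].
rewrite -(card_cell la) mdegE -sum1_card (partition_big T xpredT) //=.
by apply: eq_bigr => v _; rewrite sum1dep_card (eqP (hw v)).
Qed.

(** Letters increase strictly down a column, starting from at least 0. *)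
Lemma semistandard_row_le N (la : 'X_{1..N}) (T : {ffun cell la -> 'I_N}) i (j : 'I_(la i)) :
  is_part la -> semistandard T -> (i <= T (cell_at j))%N.
Proof.
move=> hla sT; case: i j => i; elim: i => // i IH iN j.
pose i' := Ordinal (ltnW iN).
have jla : (j < la i')%N by apply: leq_trans (ltn_ord j) (is_part_le hla _) => /=.
apply: leq_ltn_trans (IH _ (Ordinal jla)) _.
exact: semistandard_column.
Qed.

(** The [r] smallest letters all lie in the first [r] rows. *)
Lemma kostka_dominated N (la mu : 'X_{1..N}) : is_part la ->
  kostka la mu != 0%N -> dominated mu la.
Proof.
move=> hla; rewrite -lt0n => /card_gt0P[T]; rewrite inE => /andP[sT /forallP hw].
apply/forallP => r.
have -> : (\sum_(i < N | i < r) mu i = #|[set c | T c < r]|)%N.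
  rewrite -sum1dep_card (partition_big T (fun v : 'I_N => v < r)%N) //=.
  apply: eq_bigr => v vr; rewrite -(eqP (hw v)) -sum1dep_card; apply: eq_bigl => c.
  by case: eqVneq => [->|]; rewrite ?vr ?andbF.
have -> : (\sum_(i < N | i < r) la i = #|[set c : cell la | row_of c < r]|)%N.
  rewrite -sum1dep_card (eq_bigr (fun i => \sum_(j < la i) 1)%N); last first.
    by move=> i _; rewrite sum1_card card_ord.
  by rewrite sig_big_dep /=; apply: eq_bigl => c; rewrite andbT.
apply/subset_leq_card/subsetP => -[i j]; rewrite !inE.
by apply: leq_ltn_trans; apply: semistandard_row_le.
Qed.

(** * Symmetric polynomials times the determinant *)

(** In the summand of [w] the polynomial [p] is written in the variables
    renamed by [w]; this is where its symmetry enters. *)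
Lemma symmetric_mul_wrD (F : fieldType) n k (p : {mpoly F[k * n]}) d (a : 'X_{1..k * n})
  (x := fun i : 'I_(k * n) => 'X_i : {mpoly F[k * n]}) :
  p \is symmetric -> (msize p <= d)%N ->
  p * wrD x a = \sum_(m : 'X_{1..(k * n) < d}) p@_m *: wrD x (a + m)%MM.
Proof.
move=> /issymP symp pd; rewrite /wrD /detk.
under [RHS]eq_bigr => m _ do rewrite scaler_sumr.
rewrite exchange_big mulr_sumr /=; apply: eq_bigr => w _.
have pE : p = \sum_(m : 'X_{1..(k * n) < d}) p@_m *: \prod_j x (w j) ^+ m j.
  rewrite -[LHS](symp w) {1}(mpolywE pd) raddf_sum /=; apply: eq_bigr => m _.
  rewrite msymZ mpolyXE_id rmorph_prod /=; congr (_ *: _).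
  by apply: eq_bigr => j _; rewrite rmorphXn /= /msym mmapX mmap1U.
rewrite {1}pE mulr_suml; apply: eq_bigr => m _.
rewrite -scalerAl -scalerAr !scalerA; congr (_ *: _).
rewrite -big_split /=; apply: eq_bigr => j _.
by rewrite !mxE mnmDE exprD mulrC.
Qed.

Lemma is_partP N (mu : 'X_{1..N}) : reflect (sorted geq mu) (is_part mu).
Proof.
rewrite (sorted_pairwise (leT := geq)); last by move=> a b c ba ac; apply: leq_trans ac ba.
apply: (iffP forallP) => [h|/(pairwiseP 0%N) h i].
  apply/(pairwiseP 0%N) => i j; rewrite !inE !size_tuple => iN jN ij.
  have /forallP/(_ (Ordinal jN)) := h (Ordinal iN).
  by rewrite !(mnm_nth 0%N) /= (ltnW ij).
apply/forallP => j; apply/implyP; rewrite leq_eqVlt => /predU1P[e|ij].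
  by rewrite (ord_inj e).
by have := h i j; rewrite !inE !size_tuple !ltn_ord !(mnm_nth 0%N); apply.
Qed.

Lemma mdeg_mperm N (mu : 'X_{1..N}) s : mdeg (Defs.mperm mu s) = mdeg mu.
Proof. exact: mpoly.mdeg_mperm. Qed.

Definition sort_mnm N (m : 'X_{1..N}) : 'X_{1..N} := Multinom (sort_tuple geq m).

Lemma sort_mnm_part N (m : 'X_{1..N}) : is_part (sort_mnm m).
Proof.
by apply/is_partP/sort_sorted => i j; apply: leq_total.
Qed.

Lemma mdeg_perm_eq N (m m' : 'X_{1..N}) : perm_eq m m' -> mdeg m = mdeg m'.
Proof. by move=> h; rewrite /mdeg; apply: perm_big. Qed.

Lemma sort_mnm_mperm N (m : 'X_{1..N}) : exists s, m = mperm (sort_mnm m) s.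
Proof.
have /tuple_permP[s hs] : perm_eq (m : seq nat) (sort_tuple geq m).
  by rewrite perm_sym perm_sort.
exists s; do 2!apply: val_inj; rewrite [LHS]hs.
by [].
Qed.

Lemma sort_mperm N (mu : 'X_{1..N}) s : is_part mu -> sort_mnm (mperm mu s) = mu.
Proof.
move=> /is_partP pmu; apply: val_inj; apply: val_inj => /=.
apply: (sorted_eq (leT := geq)) => //.
- by move=> a b c ba ac; apply: leq_trans ac ba.
- by move=> a b; rewrite /geq /= andbC -eqn_leq => /eqP.
- by apply: sort_sorted => a b; apply: leq_total.
rewrite perm_sort; apply/tuple_permP; by exists s.
Qed.

Lemma mperm_eqP N (mu : 'X_{1..N}) (s t : 'S_N) :
  reflect (mperm mu s = mperm mu t) (t \in s *: stab mu)%g.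
Proof.
rewrite mem_lcoset inE; apply: (iffP forallP) => [h|/mnmP h i].
  apply/mnmP => i; rewrite !mnmE; have /eqP := h (s i).
  by rewrite permM permK.
by have := h (s^-1 i)%g; rewrite !mnmE permKV permM => <-.
Qed.

(** The rearrangements of [mu] correspond to the cosets of its stabilizer,
    hence to the elements of a transversal. *)
Lemma sum_orbit N d (mu : 'X_{1..N}) (X : {set 'S_N}) (V : nmodType) (G : 'X_{1..N} -> V) :
  is_part mu -> (mdeg mu < d)%N ->
  is_transversal X (stab_cosets mu) [set: 'S_N] ->
  \sum_(m : 'X_{1..N < d} | sort_mnm m == mu) G m = \sum_(s in X) G (mperm mu s).
Proof.
move=> pmu dmu hX.
have dm s : (mdeg (mperm mu s) < d)%N by rewrite mdeg_mperm.
pose h s : 'X_{1..N < d} := BMultinom (dm s).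
have /and3P[_ _ /forall_inP card1] := hX.
have meets s : exists t, X :&: (s *: stab mu)%g = [set t].
  by apply/cards1P/card1/lcosetsP; exists s; rewrite ?inE.
have injh : {in X &, injective h}.
  move=> s t sX tX /(congr1 val) /mperm_eqP ts.
  have ss : s \in (s *: stab mu)%g by apply/mperm_eqP.
  have [u /setP hu] := meets s.
  have := hu s; have := hu t; rewrite !inE sX ts tX ss => /esym/eqP-> /esym/eqP->//.
transitivity (\sum_(m in h @: X) G m); last by rewrite big_imset.
apply: eq_bigl => m; apply/eqP/imsetP => [e|[s sX ->]]; last exact: sort_mperm.
have [s ms] := sort_mnm_mperm m; have [t /setP/(_ t)] := meets s.
rewrite !inE eqxx => /andP[tX /mperm_eqP st]; exists t => //.
by apply: val_inj; rewrite /= -st -e -ms.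
Qed.

(** * Nonvanishing of the wreath determinant *)

(** The stabilizer of [g] is trivial if [g] is injective.  Otherwise it contains
    a transposition, and multiplication by it exchanges the even and the odd
    elements. *)
Lemma sum_sign_stabilizer (R : nzRingType) N (T : eqType) (g : 'I_N -> T) :
  \sum_(w : 'S_N | [forall i, g (w i) == g i]) (-1) ^+ w = (injectiveb g)%:R :> R.
Proof.
have [/injectiveP injg|/injectivePn[i [j ij gij]]] := boolP (injectiveb g).
  rewrite (big_pred1 1%g) ?odd_perm1 // => w; apply/forallP/eqP => [h|-> i].
    by apply/permP => i; rewrite perm1; apply: injg; apply/eqP.
  by rewrite perm1.
rewrite (bigID (@odd_perm _)) /=.
rewrite (reindex_inj (mulgI (tperm i j))) /=.
apply/eqP; rewrite addr_eq0 -sumrN; apply/eqP; apply: eq_big => [w|w /andP[_]].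
  rewrite odd_permM odd_tperm ij; congr (_ && _).
  have gt l : g (tperm i j l) = g l by case: tpermP => [->|->|].
  apply/forallP/forallP => h l; have := h (tperm i j l).
    by rewrite permM tpermK gt.
  by rewrite permM gt.
by rewrite odd_permM odd_tperm ij /= => /negPf ->; rewrite expr1 expr0.
Qed.

(** A function is fixed by [w] exactly if it factors through the cycles of
    [w]. *)
Lemma card_invariant_ffun N k (w : 'S_N) :
  #|[set f : {ffun 'I_N -> 'I_k} | [forall i, f (w i) == f i]]| = (k ^ #|porbits w|)%N.
Proof.
(* Functions on the cycles, composed with [i |-> porbit w i], give the fixed functions. *)
pose D := {O : {set 'I_N} | O \in porbits w}.
have mem i : porbit w i \in porbits w by apply: imset_f.
pose q i : D := exist _ (porbit w i) (mem i).
pose h (g : {ffun D -> 'I_k}) : {ffun 'I_N -> 'I_k} := [ffun i => g (q i)].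
have injh : injective h.
  move=> g g' /ffunP e; apply/ffunP => -[O hO]; have /imsetP[i _ Oi] := hO.
  have := e i; rewrite !ffunE; congr (_ = _); congr (fun_of_fin _ _); exact: val_inj.
have -> : [set f : {ffun 'I_N -> 'I_k} | [forall i, f (w i) == f i]] = h @: setT.
  apply/setP => f; rewrite inE; apply/forallP/imsetP => [inv|[g _ ->] i].
    have hO (O : D) : exists i, i \in val O.
      by case: O => O /= /imsetP[i _ ->]; exists i; rewrite porbit_id.
    exists [ffun O => f (xchoose (hO O))]; first by rewrite inE.
    apply/ffunP => i; rewrite !ffunE.
    have := xchooseP (hO (q i)); rewrite /= => /porbitP[m ->].
    by elim: m => [|m IH]; rewrite ?perm1 // expgSr permM (eqP (inv _)).
  rewrite !ffunE; apply/eqP; congr (g _); apply: val_inj => /=.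
  by rewrite -[w i]/((w ^+ 1)%g i) porbit_perm.
by rewrite card_imset // cardsT card_ffun card_ord card_sig; congr (_ ^ _)%N; apply: eq_card.
Qed.

Lemma ncycles_le N (w : 'S_N) : (ncycles w <= N)%N.
Proof. by rewrite -[leqRHS]card_ord leq_imset_card. Qed.

(** The scalars of [detk] are, up to the factor [k^-N], the signed permutation
    character of ['S_N] on the maps ['I_N -> 'I_k].  This replaces the cycle
    count by a sum over maps, which can be exchanged with the sum over [w]. *)
Lemma detk_scalarE (F : fieldType) N k (w : 'S_N) : (k%:R != 0 :> F) ->
  (- k%:R^-1 : F) ^+ (N - ncycles w) = k%:R ^- N *
    ((-1) ^+ w *  #|[set f : {ffun 'I_N -> 'I_k} | [forall i, f (w i) == f i]]|%:R).
Proof.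
move=> k0; rewrite card_invariant_ffun [LHS]exprNn [RHS]mulrCA.
have -> : (-1) ^+ (N - ncycles w) = (-1) ^+ w :> F.
  by rewrite -[LHS]signr_odd oddB ?ncycles_le // /odd_perm card_ord.
congr (_ * _); rewrite natrX exprVn.
by rewrite expfB_cond ?(negPf k0) ?ncycles_le // invf_div mulrC.
Qed.

(** The permutations [w] that contribute to the monomial [x^delta] are those
    that preserve [delta].  Summing their signs over those that also fix [f]
    tests the joint injectivity of [delta] and [f]. *)
Lemma wrD_delta_coeff (F : fieldType) n k
    (x := fun i : 'I_(k * n) => 'X_i : {mpoly F[k * n]}) :
  (0 < k)%N -> [pchar F] =i pred0 ->
  (wrD x (delta n k))@_(delta n k) = k%:R ^- (k * n) *
    #|[set f : {ffun 'I_(k * n) -> 'I_k} | injectiveb (fun i => (delta n k i, f i))]|%:R.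
Proof.
move=> k_gt0 charF; have k0 : k%:R != 0 :> F by rewrite (pcharf0P F).1 // -lt0n.
rewrite /wrD /detk raddf_sum /=.
have coefE (w : 'S_(k * n)) :
    (\prod_(j < k * n) (\matrix_(i, j) x i ^+ delta n k j) (w j) j)@_(delta n k)
    = [forall i, delta n k (w i) == delta n k i]%:R.
  have -> : \prod_(j < k * n) (\matrix_(i, j) x i ^+ delta n k j) (w j) j
      = 'X_[Defs.mperm (delta n k) w^-1].
    rewrite (mpolyXE _ w); apply: eq_bigr => j _.
    by rewrite mxE; congr (_ ^+ _); rewrite [RHS]mnmE permK.
  rewrite mcoeffX; congr (_ : bool)%:R.
  apply/eqP/forallP => [/mnmP h i|h].
    by have := h (w i); rewrite [LHS]mnmE permK => ->.
  by apply/mnmP => i; rewrite [LHS]mnmE -(eqP (h _)) permKV.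
under eq_bigr => w _ do rewrite mcoeffZ coefE detk_scalarE // -mulrA.
rewrite -mulr_sumr; congr (_ * _).
rewrite -sum1dep_card natr_sum [RHS]big_mkcond /=.
under [RHS]eq_bigr => f _.
  have -> : (if injectiveb (fun i => (delta n k i, f i)) then 1 else 0) =
     \sum_(w : 'S_(k * n) |
         [forall i, (delta n k (w i), f (w i)) == (delta n k i, f i)])
       (-1) ^+ w :> F.
    by rewrite sum_sign_stabilizer; case: ifP.
  rewrite big_mkcond.
  over.
rewrite exchange_big /=; apply: eq_bigr => w _.
rewrite -sum1dep_card natr_sum mulr_sumr mulr_suml big_mkcond /=.
apply: eq_bigr => f _.
have -> : [forall i, (delta n k (w i), f (w i)) == (delta n k i, f i)] =
  [forall i, f (w i) == f i] && [forall i, delta n k (w i) == delta n k i].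
  apply/forallP/andP => [h|[/forallP h1 /forallP h2] i].
    by split; apply/forallP => i; have := h i; rewrite xpair_eqE => /andP[].
  by rewrite xpair_eqE h1 h2.
by case: ifP => //= _; case: ifP => _; rewrite ?mulr0 // !mulr1.
Qed.

Lemma wrD_delta_neq0 (F : fieldType) n k
    (x := fun i : 'I_(k * n) => 'X_i : {mpoly F[k * n]}) :
  (0 < k)%N -> [pchar F] =i pred0 -> wrD x (delta n k) != 0.
Proof.
move=> k_gt0 charF; apply/eqP => /(congr1 (mcoeff (delta n k))).
have nat0 := (pcharf0P F).1 charF.
rewrite wrD_delta_coeff // mcoeff0; apply/eqP.
rewrite mulf_neq0 ?invr_neq0 ?expf_neq0 ?nat0 -?lt0n //.
(* [delta] determines the quotient of [i] by [k], and this function its remainder. *)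
apply/card_gt0P; exists [ffun i : 'I_(k * n) => Ordinal (ltn_pmod i k_gt0)].
rewrite inE; apply/injectiveP => i j; rewrite /= !mnmE !ffunE => -[dij mij].
have lt_n (l : 'I_(k * n)) : (l %/ k < n)%N by apply: colblock_subproof.
apply: val_inj; rewrite /= (divn_eq i k) (divn_eq j k) mij; congr (_ * _ + _)%N.
have := lt_n i; have := lt_n j; lia.
Qed.

Lemma wrdet_wrV (F : fieldType) n k (A : comAlgType F) (x : 'I_(k * n) -> A) :
  wrdet (wrV x) = wrD x (delta n k).
Proof.
rewrite /wrdet /wrD; congr (detk _ _); apply/matrixP => i j.
by rewrite !mxE mnmE /= -subnDA.
Qed.

(** * The expansion *)

Lemma msize_schur_poly (F : fieldType) N (la : 'X_{1..N}) :
  (msize (schur_poly F la) <= (mdeg la).+1)%N.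
Proof.
rewrite msizeE; apply/bigmax_leqP_seq => m; rewrite mcoeff_msupp mcoeff_schur_poly.
move=> nz _; rewrite ltnS (@kostka_mdeg _ la m) //.
by apply: contraNneq nz => ->.
Qed.

(** Exponents are grouped by their decreasing rearrangement [mu].  The Kostka
    number is constant on each group because it is a coefficient of a symmetric
    polynomial, and it vanishes unless [mu] is dominated by [la]. *)
Lemma schur_poly_mul_wrD (F : fieldType) n k (la : 'X_{1..k * n})
    (reps : 'X_{1..k * n} -> {set 'S_(k * n)}) (a : 'X_{1..k * n})
    (x := fun i : 'I_(k * n) => 'X_i : {mpoly F[k * n]}) : is_part la ->
  (forall mu, is_part mu ->
     is_transversal (reps mu) (stab_cosets mu) [set: 'S_(k * n)]) ->
  schur_poly F la * wrD x a =
  \sum_(mu : 'X_{1..(k * n) < (mdeg la).+1} |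
            [&& is_part mu, dominated mu la & mdeg mu == mdeg la])
      \sum_(s in reps mu) (kostka la mu)%:R * wrD x (a + Defs.mperm mu s)%MM.
Proof.
move=> hla hreps; have sym := schur_poly_sym F hla.
rewrite (symmetric_mul_wrD _ sym (msize_schur_poly F la)).
pose G m := (schur_poly F la)@_m *: wrD x (a + m)%MM.
have mdeg_sort (m : 'X_{1..(k * n) < (mdeg la).+1}) : (mdeg (sort_mnm m) < (mdeg la).+1)%N.
  rewrite (_ : mdeg (sort_mnm m) = mdeg m) ?bmdeg //.
  by apply: mdeg_perm_eq; rewrite perm_sort.
pose srt m : 'X_{1..(k * n) < (mdeg la).+1} := BMultinom (mdeg_sort m).
rewrite (partition_big srt (fun mu => is_part mu)) /=; last first.
  by move=> m _; apply: sort_mnm_part.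
rewrite (bigID (fun mu : 'X_{1..(k * n) < (mdeg la).+1} =>
                  dominated mu la && (mdeg mu == mdeg la))) /=.
have orbitE (mu : 'X_{1..(k * n) < (mdeg la).+1}) : is_part mu ->
    \sum_(m | srt m == mu) G m =
    \sum_(s in reps mu) (kostka la mu)%:R * wrD x (a + Defs.mperm mu s)%MM.
  move=> pmu; transitivity (\sum_(s in reps mu) G (Defs.mperm mu s)).
    rewrite -(sum_orbit G pmu (bmdeg mu)) ?hreps //.
  apply: eq_bigr => s _; rewrite /G.
  by rewrite (msym_coeff _ _ sym) mcoeff_schur_poly scaler_nat mulr_natl.
rewrite [X in _ + X]big1 ?addr0 => [|mu /andP[pmu ndom]].
  by apply: eq_bigr => mu /andP[pmu _]; apply: orbitE.
rewrite orbitE // big1 // => s _.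
suff -> : kostka la mu = 0%N by rewrite mul0r.
apply/eqP; apply: contraNT ndom => nz.
by rewrite kostka_dominated // (kostka_mdeg nz) eqxx.
Qed.

Theorem proposition6p8 (R : realType) (n k : nat) (hn : (0 < n)%N)
  (hk : (0 < k)%N) (la : 'X_{1..k * n}) (hla : is_part la)
  (reps : 'X_{1..k * n} -> {set 'S_(k * n)})
  (hreps : forall mu : 'X_{1..k * n}, is_part mu ->
     is_transversal (reps mu) (stab_cosets mu) [set: 'S_(k * n)]) :
  let C : fieldType := complex R in
  let x : 'I_(k * n) -> {mpoly C[k * n]} := fun i => 'X_i in
  schur C la =
    1 / FracField.tofrac (wrdet (wrV x)) *
    \sum_(mu : 'X_{1..(k * n) < (mdeg la).+1} |
            [&& is_part mu, dominated mu la & mdeg mu == mdeg la])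
      \sum_(s in reps mu)
        (kostka la mu)%:R *
        FracField.tofrac (wrD x (delta n k + mperm mu s)%MM).
Proof.
move=> C x.
have charC : [pchar C] =i pred0 by exact: Num.Theory.pchar_num.
rewrite schur_fraction // wrdet_wrV mul1r mulrC.
have W0 : FracField.tofrac (wrD x (delta n k)) != 0.
  by rewrite tofrac_eq0 wrD_delta_neq0.
apply: (mulIf W0); rewrite divfK // -rmorphM /=.
rewrite (schur_poly_mul_wrD _ _ hla hreps) rmorph_sum /=.
apply: eq_bigr => mu _; rewrite rmorph_sum /=; apply: eq_bigr => s _.
by rewrite rmorphM rmorph_nat.
Qed.
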